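(* Let $\varepsilon$ be a finite soft excursion. Then the slot diagram $x^{\diamond}[\varepsilon]$ of the Head-Tail (HT) soliton decomposition of $\varepsilon$ coincides with the slot diagram $x[\varepsilon]$ of the Takahashi-Satsuma (TS) soliton decomposition of $\varepsilon$; that is, $x[\varepsilon]=x^{\diamond}[\varepsilon]$.
   Context: **Excursions.** A finite soft excursion of length $2n$ ($n\ge 0$) is a sequence $\varepsilon=(\varepsilon(0),\dots,\varepsilon(2n))$ of nonnegative integers with $\varepsilon(0)=\varepsilon(2n)=0$ and $|\varepsilon(i)-\varepsilon(i-1)|=1$ for $1\le i\le 2n$ (for $n=0$ it is the empty excursion). Its ball configuration is $\eta\in\{0,1\}^{\mathbb Z}$ with $2\eta(i)-1=\varepsilon(i)-\varepsilon(i-1)$ for $1\le i\le 2n$ and $\eta(i)=0$ for all other $i$. Elements of $\mathbb Z$ are called boxes; box $i$ is occupied if $\eta(i)=1$ and empty if $\eta(i)=0$. Box $0$ is the record preceding the excursion and box $2n+1$ is the next record. **Runs.** A run is a maximal interval of consecutive boxes with the same value of $\eta$ (a zero-run or a one-run); its size is its number of boxes (possibly $+\infty$). After some boxes have been deleted (ignored), runs are computed on the remaining boxes in their inherited order. **TS decomposition.** Repeat the following until only one infinite zero-run remains: take the leftmost among the runs of smallest size; let $k$ be its size. The $k$ boxes of this run together with the first (leftmost) $k$ boxes of the neighboring run to its right form a $k$-soliton $\gamma$. Denote its occupied boxes (head) by $\mathtt h_1(\gamma)<\dots<\mathtt h_k(\gamma)$ and its empty boxes (tail) by $\mathtt t_1(\gamma)<\dots<\mathtt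 t_k(\gamma)$. Delete the boxes of $\gamma$, update the runs and repeat. **HT decomposition.** Repeat the following until only one infinite run remains: take the leftmost among the runs of smallest size; let $k$ be its size. If it is a one-run, pair its boxes with the first (leftmost) $k$ boxes of the neighboring zero-run to its right. If it is a zero-run, pair its boxes with the nearest (rightmost) $k$ boxes of the neighboring one-run to its left. The $2k$ boxes form a $k$-soliton$^\diamond$ $\gamma^\diamond$, with occupied boxes $\mathtt h_1(\gamma^\diamond)<\dots<\mathtt h_k(\gamma^\diamond)$ and empty boxes $\mathtt t_1(\gamma^\diamond)<\dots<\mathtt t_k(\gamma^\diamond)$. Delete these boxes, update the runs and repeat. **Slots.** For $k\ge1$, the $k$-slots of the excursion (for TS) are box $0$ and all boxes of the form $\mathtt h_\ell(\gamma)$ or $\mathtt t_\ell(\gamma)$ with $\ell>k$, where $\gamma$ is an $m$-soliton of the TS decomposition with $m>k$. The $k$-slots$^\diamond$ (for HT) are box $0$ and all boxes of the form $\mathtt h_\ell(\gamma^\diamond)$ or $\mathtt t_{m-\ell+1}(\gamma^\diamond)$ with $\ell\in\{1,\dots,m-k\}$, where $\gamma^\diamond$ is an $m$-soliton$^\diamond$ of the HT decomposition with $m>k$. In each case the $k$-slots are enumerated from left to right starting with number $0$ for box $0$; the number of them in the excursion is $s_k=1+\sum_{\ell>k}2(\ell-k)n_\ell$, with $n_\ell$ the number of $\ell$-solitons of the decomposition considered. The slot after the last one is understood to be the next record, box $2n+1$. **Slot diagrams.** A $k$-soliton is attached to $k$-slot number $i$ if all its boxes lie strictly between the $k$-slots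 number $i$ and $i+1$ (same definition with $\diamond$). Set $x_k(i)$ := number of $k$-solitons attached to $k$-slot number $i$, for $0\le i<s_k$, and $x_k^\diamond(i)$ := number of $k$-solitons$^\diamond$ attached to $k$-slot$^\diamond$ number $i$. With $M$ the largest soliton size in the decomposition ($M=0$ for the empty excursion), the slot diagram is the family of vectors $x[\varepsilon]=(x_k:1\le k\le M)$, $x_k=(x_k(0),\dots,x_k(s_k-1))$, for TS, and $x^\diamond[\varepsilon]=(x_k^\diamond:1\le k\le M^\diamond)$, defined in the same way (with $M^\diamond$ the largest soliton$^\diamond$ size), for HT. *)

(* Defs.v *)
From mathcomp Require Import all_boot all_order all_algebra.

Set Implicit Arguments.
Unset Strict Implicit.
Unset Printing Implicit Defensive.

Import Order.TTheory GRing.Theory Num.Theory.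

Definition soft_excursion (n : nat) (eps : seq nat) : Prop :=
  [/\ size eps = n.*2.+1,
      nth 0 eps 0 = 0,
      nth 0 eps n.*2 = 0
    & forall i, 1 <= i <= n.*2 ->
        (`|(nth 0 eps i)%:Z - (nth 0 eps i.-1)%:Z| = 1)%R].

Definition ball_config (n : nat) (eps : seq nat) (i : int) : bool :=
  if i is Posz j then
    (1 <= j <= n.*2) && ((nth 0 eps j)%:Z - (nth 0 eps j.-1)%:Z == 1)%R
  else false.

(* Splits an increasing list of boxes into its maximal blocks on which eta is *)
(* constant, from left to right.                                              *)
Fixpoint runs (eta : int -> bool) (s : seq nat) : seq (seq nat) :=
  if s is i :: s' then
    match runs eta s' with
    | (j :: r) :: rs =>
        if eta i == eta j then (i :: j :: r) :: rs
        else [:: i] :: (j :: r) :: rs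
    | _ => [:: [:: i]]
    end
  else [::].

(* The configuration is seen through a finite window of boxes (see            *)
(* decomposition), whose first and last runs are the visible parts of the two *)
(* infinite zero-runs (or of the only one). The finite runs are thus those of *)
(* index 1, ..., size rs - 2. The result lists, from left to right, the       *)
(* indices of those of smallest size; it is empty iff only infinite runs      *)
(* remain.                                                                    *)
Definition smallest_runs (rs : seq (seq nat)) : seq nat :=
  let finite := iota 1 (size rs).-2 in
  [seq p <- finite |
    all (fun q => size (nth [::] rs p) <= size (nth [::] rs q)) finite].

(* [TS_boxes eta rs p] and [HT_boxes eta rs p] are the boxes, in increasing   *)
(* order, of the soliton created from the run of index p in rs.               *)
Definition TS_boxes (eta : int -> bool) (rs : seq (seq nat)) (p : nat) :
    seq nat :=
  let r := nth [::] rs p in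
  r ++ take (size r) (nth [::] rs p.+1).

Definition HT_boxes (eta : int -> bool) (rs : seq (seq nat)) (p : nat) :
    seq nat :=
  let r := nth [::] rs p in
  let left_run := nth [::] rs p.-1 in
  if eta (head 0 r) then r ++ take (size r) (nth [::] rs p.+1)
  else drop (size left_run - size r) left_run ++ r.

Record soliton := Soliton { heads : seq nat; tails : seq nat }.

Definition soliton_of_boxes (eta : int -> bool) (bs : seq nat) : soliton :=
  Soliton [seq i : nat <- bs | eta i] [seq i : nat <- bs | ~~ eta i].

Definition soliton_size (g : soliton) : nat := size (heads g).
Definition soliton_boxes (g : soliton) : seq nat := heads g ++ tails g.

Definition head_box (g : soliton) (l : nat) : nat := nth 0 (heads g) l.-1.
Definition tail_box (g : soliton) (l : nat) : nat := nth 0 (tails g) l.-1.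

Fixpoint decomposition_rec
    (boxes_of : (int -> bool) -> seq (seq nat) -> nat -> seq nat)
    (eta : int -> bool) (fuel : nat) (s : seq nat) : seq soliton :=
  if fuel is m.+1 then
    let rs := runs eta s in
    if smallest_runs rs is p :: _ then
      let bs := boxes_of eta rs p in
      soliton_of_boxes eta bs
        :: decomposition_rec boxes_of eta m [seq i <- s | i \notin bs]
    else [::]
  else [::].

(* There are n balls, and each soliton consists of k >= 1 balls and k empty   *)
(* boxes. Hence at most n steps are performed, and at most n empty boxes are  *)
(* ever deleted. Boxes i <= 0 always belong to the left infinite zero-run,    *)
(* from which nothing is taken, and boxes i > 2n to the right one, from which *)
(* boxes are taken from its left end only. The window 0, ..., 3n+1 therefore  *)
(* always meets both infinite runs and contains every box that is needed.     *)
Definition decomposition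
    (boxes_of : (int -> bool) -> seq (seq nat) -> nat -> seq nat)
    (n : nat) (eps : seq nat) : seq soliton :=
  decomposition_rec boxes_of (ball_config n eps) n (iota 0 (3 * n).+2).

Definition TS_decomposition := decomposition TS_boxes.
Definition HT_decomposition := decomposition HT_boxes.

(* The solitons of a decomposition are pairwise disjoint and avoid box 0, so  *)
(* the lists of slots below have no repetitions.                              *)
Definition TS_slots (D : seq soliton) (k : nat) : seq nat :=
  sort leq (0 :: flatten
    [seq [seq head_box g l | l <- iota k.+1 (soliton_size g - k)] ++
         [seq tail_box g l | l <- iota k.+1 (soliton_size g - k)]
    | g <- D & k < soliton_size g]).

Definition HT_slots (D : seq soliton) (k : nat) : seq nat :=
  sort leq (0 :: flatten
    [seq [seq head_box g l | l <- iota 1 (soliton_size g - k)] ++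
         [seq tail_box g (soliton_size g - l + 1)
         | l <- iota 1 (soliton_size g - k)]
    | g <- D & k < soliton_size g]).

(* [sl] lists the k-slots, [next_record] plays the role of the slot following *)
(* the last one.                                                              *)
Definition attached (sl : seq nat) (next_record i : nat) (g : soliton) : bool :=
  all (fun b => nth next_record sl i < b < nth next_record sl i.+1)
      (soliton_boxes g).

Definition slot_vector (slots : seq soliton -> nat -> seq nat) (n : nat)
    (D : seq soliton) (k : nat) : seq nat :=
  mkseq (fun i => count (attached (slots D k) n.*2.+1 i)
                        [seq g <- D | soliton_size g == k])
        (size (slots D k)).

Definition max_soliton_size (D : seq soliton) : nat :=
  \max_(g <- D) soliton_size g.

(* The vectors x_1, ..., x_M in this order. *)
Definition slot_diagram (slots : seq soliton -> nat -> seq nat) (n : nat)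
    (D : seq soliton) : seq (seq nat) :=
  [seq slot_vector slots n D k | k <- iota 1 (max_soliton_size D)].

Definition TS_slot_diagram (n : nat) (eps : seq nat) : seq (seq nat) :=
  slot_diagram TS_slots n (TS_decomposition n eps).

Definition HT_slot_diagram (n : nat) (eps : seq nat) : seq (seq nat) :=
  slot_diagram HT_slots n (HT_decomposition n eps).

(* Main.v *)
Require Import Defs.
From mathcomp Require Import all_boot all_order all_algebra.
From mathcomp Require Import zify.

Set Implicit Arguments.
Unset Strict Implicit.
Unset Printing Implicit Defensive.

(** Both decompositions transform the sequence of run sizes in the same way.
    When the leftmost smallest run, of size m, is a one-run, they remove the
    same boxes. When it is a zero-run between one-runs of sizes x and y, TS
    removes it with m balls on its right and HT with m balls on its left; either
    way a single one-run of size x + y - m remains. So at each stage the two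
    sets of remaining boxes have the same run sizes, although they differ as
    sets, and the next soliton has the same size k in both. It remains to see
    that the two k-solitons are attached to the k-slots of the same number.

    Suppose that all runs have size at least k. By induction on the number of
    runs, the boxes that are not k-slots are, for TS, the first k boxes of every
    run, and, for HT, the last k boxes of every one-run and the first k boxes of
    every zero-run ([decomposition_data]; the inductive step is
    [removal_right] and [removal_left]). Thus a run of size a carries a - k
    slots in both cases. If the runs a_0, a_1, ... are all of size at least k
    and a_p = k, the k-soliton created from run p has on its left the slots of
    the runs before p and no others: when HT starts the soliton in run p - 1, it
    takes the last k boxes of that run, none of which is a slot. The soliton is
    therefore attached to slot number (a_0 - k) + ... + (a_{p-1} - k).

    Solitons are created in nondecreasing order of size, so those removed
    before a k-soliton contribute no k-slot. Hence the list of pairs (size,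
    number of the slot of attachment) is a function [soliton_data] of the run
    sizes only, and it determines the slot diagram ([slot_diagram_data]).

    The runs considered are those of the boxes of the excursion, without box 0
    and without the boxes after the excursion. Nonnegativity of the excursion,
    in the form [dyck] on run sizes, makes the last zero-run long enough for
    this, and makes the second run equal in size to the first one when the
    first one is the smallest. *)

(** * Excursions in terms of run sizes *)

(** The entries of [sh] are the lengths of the alternate runs of ups and downs of
    a path from height [h] to 0; it is nonnegative as soon as it is so at the end
    of each run of downs. The condition [up] at the end forces the last run to
    be one of downs. *)
Fixpoint dyck (up : bool) (h : nat) (sh : seq nat) : bool :=
  if sh is a :: sh' then
    if up then dyck false (h + a) sh' else (a <= h) && dyck true (h - a) sh'
  else up && (h == 0).

Lemma odd_size_dyck up h sh : dyck up h sh -> odd (size sh) = ~~ up.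
Proof.
elim: sh up h => [|a sh IH] [] h //=; first by move/IH=> ->.
by case/andP=> _ /IH ->.
Qed.

(** The last run is a run of downs that reaches height 0, hence it is at least
    as long as the run of ups just before it. This allows the last run of an
    excursion, which is not among the candidates for the smallest run, to be
    treated as the others. *)
Lemma dyck_last_ge up h sh z k :
  sh != [::] -> dyck up h (rcons sh z) -> {in sh, forall a, k <= a} -> k <= z.
Proof.
elim: sh up h => // a [|b sh] IH up h _.
  move=> /= dy /(_ a); rewrite mem_head => /(_ isT) ka; move: dy.
  by case: up => /=; [lia | rewrite andbF].
move=> dy ge_k; have ge_k' : {in b :: sh, forall c, k <= c}.
  by move=> c c_sh; apply: ge_k; rewrite inE c_sh orbT.
have [up' [h' dy']] : exists up' h', dyck up' h' (rcons (b :: sh) z).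
  by case: up dy => [dy | /andP[_ dy]]; [exists false, (h + a) | exists true, (h - a)].
exact: (IH up' h').
Qed.

(** Cutting a peak or a valley of size [m] off a path keeps it nonnegative; on
    run sizes both operations are the same merging of three runs. *)
Lemma dyck_merge up h s1 s2 x m y : m <= x -> m <= y ->
  dyck up h (s1 ++ [:: x, m, y & s2]) -> dyck up h (s1 ++ (x + y - m) :: s2).
Proof.
move=> mx my; elim: s1 up h => [|a s1 IH] [] h /=.
- by case/andP=> _; rewrite (_ : h + x - m + y = h + (x + y - m)); lia.
- case/and3P=> xh yh dy.
  by rewrite (_ : h - (x + y - m) = h - x + m - y) ?dy ?andbT; lia.
- exact: IH.
- by case/andP=> -> /IH.
Qed.

(** The last run is excluded because it continues into the infinite zero-run. *)
Definition min_index (sh : seq nat) : nat :=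
  let finite := iota 0 (size sh).-1 in
  head 0 [seq p <- finite | all (fun q => nth 0 sh p <= nth 0 sh q) finite].

Lemma min_index_mem sh : 1 < size sh ->
  [seq p <- iota 0 (size sh).-1 |
     all (fun q => nth 0 sh p <= nth 0 sh q) (iota 0 (size sh).-1)] != [::].
Proof.
move=> sh_gt1; rewrite -has_filter; apply/hasP.
have sz0 : 0 < (size sh).-1 by lia.
case: (@arg_minnP _ (Ordinal sz0) predT (fun i => nth 0 sh i)) => // i _ min_i.
exists (val i); first by rewrite mem_iota /=; have := ltn_ord i; lia.
apply/allP=> q; rewrite mem_iota /= add0n => q_lt.
exact: (min_i (Ordinal q_lt)).
Qed.

Lemma min_indexP sh : sh != [::] -> dyck true 0 sh ->
  (min_index sh).+1 < size sh
  /\ {in sh, forall a, nth 0 sh (min_index sh) <= a}.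
Proof.
move=> sh_neq0 dy; have sh_gt1 : 1 < size sh.
  by case: sh sh_neq0 dy => // a [|b sh].
have : min_index sh \in [seq p <- iota 0 (size sh).-1 |
     all (fun q => nth 0 sh p <= nth 0 sh q) (iota 0 (size sh).-1)].
  have := min_index_mem sh_gt1; rewrite /min_index.
  by case: filter => //= *; rewrite mem_head.
set p := min_index sh.
rewrite mem_filter mem_iota /= add0n => /andP[/allP min_p p_lt]; split; first lia.
clearbody p; case/lastP: sh sh_neq0 dy sh_gt1 min_p p_lt => // sh z _ dy.
rewrite size_rcons /= ltnS => sh_gt0 min_p p_lt.
have ge_p : {in sh, forall a, nth 0 (rcons sh z) p <= a}.
  move=> a /(nthP 0)[q q_lt <-].
  have := min_p q; rewrite mem_iota /= add0n => /(_ q_lt).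
  by rewrite (nth_rcons _ _ _ q) q_lt.
move=> a; rewrite mem_rcons inE => /predU1P[->|]; last exact: ge_p.
by apply: dyck_last_ge dy ge_p; rewrite -size_eq0 -lt0n.
Qed.

(** The effect on run sizes of removing the soliton created from run [p]. When
    [p = 0] is the smallest run of an excursion, the second run has the same
    size, so both disappear. *)
Definition merge_at (p : nat) (sh : seq nat) : seq nat :=
  if p is q.+1 then
    take q sh ++ (nth 0 sh q + nth 0 sh q.+2 - nth 0 sh q.+1) :: drop q.+3 sh
  else drop 2 sh.

Lemma merge_at_cat s1 s2 x m y :
  merge_at (size s1).+1 (s1 ++ [:: x, m, y & s2]) = s1 ++ (x + y - m) :: s2.
Proof.
have nthE j : nth 0 (s1 ++ [:: x, m, y & s2]) (size s1 + j) = nth 0 [:: x, m, y & s2] j.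
  by rewrite nth_cat ltnNge leq_addr addKn.
rewrite /merge_at take_size_cat //.
have:= nthE 0; have:= nthE 1; have:= nthE 2; rewrite addn0 addn1 addn2 => -> -> -> /=.
by rewrite -addn3 (addnC (size s1)) -drop_drop drop_size_cat //= drop0.
Qed.

(** The pairs (size, number of the slot of attachment) of the solitons, in the
    order of their creation. *)
Fixpoint soliton_data (fuel : nat) (sh : seq nat) : seq (nat * nat) :=
  if fuel is f.+1 then
    if sh is [::] then [::] else
    let p := min_index sh in
    let m := nth 0 sh p in
    (m, sumn [seq a - m | a <- take p sh]) :: soliton_data f (merge_at p sh)
  else [::].

(** * Runs of a ball configuration *)

Section Runs.
Variable eta : int -> bool.

Fixpoint alternating (b : bool) (rs : seq (seq nat)) : bool :=
  if rs is r :: rs' then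
    [&& r != [::], all (fun i : nat => eta i == b) r & alternating (~~ b) rs']
  else true.

Lemma alternating_cat b rs1 rs2 :
  alternating b (rs1 ++ rs2) =
  alternating b rs1 && alternating (b (+) odd (size rs1)) rs2.
Proof.
elim: rs1 b => [|r rs1 IH] b /=; first by rewrite addbF.
by rewrite IH -!andbA addNb addbN.
Qed.

Lemma runs_flatten b rs : alternating b rs -> runs eta (flatten rs) = rs.
Proof.
elim: rs b => //= r rs IH b /and3P[r_neq0 r_b alt_rs].
have {}IH := IH _ alt_rs.
elim: r r_neq0 r_b => // i [|i' r] IHr _ /=; rewrite -/(all _ _).
  rewrite andbT => /eqP eta_i; rewrite IH.
  case: rs alt_rs {IH IHr} => //= -[|j r] rs //= /andP[/andP[/eqP eta_j _] _].
  by rewrite eta_i eta_j; case: b {eta_i eta_j}.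
case/and3P=> /eqP eta_i /eqP eta_i' r_b.
have := IHr isT; rewrite /= eta_i' eqxx r_b => /(_ isT) ->.
by rewrite eta_i eta_i' eqxx.
Qed.

Fixpoint walk (h : nat) (s : seq nat) : bool :=
  if s is i :: s' then
    if eta i then walk h.+1 s' else (0 < h) && walk h.-1 s'
  else h == 0.

Lemma walk0_head i s : walk 0 (i :: s) -> eta i.
Proof. by rewrite /=; case: (eta i). Qed.

Lemma runs_walk h i s : walk h (i :: s) ->
  [/\ flatten (runs eta (i :: s)) = i :: s,
      alternating (eta i) (runs eta (i :: s))
    & dyck (eta i) h (map size (runs eta (i :: s)))].
Proof.
elim: s h i => [|j s IH] h i.
  rewrite /= eqxx /=; case: ifP => //= _ /andP[h1 /eqP h0].
  by rewrite h1 subn1 h0.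
rewrite [walk _ _]/= -/(walk _ (j :: s)) => wk.
have {}wk : exists2 h', walk h' (j :: s) & if eta i then h' = h.+1 else h = h'.+1.
  case: ifP wk => _; first by exists h.+1.
  by case/andP=> h0 wk; exists h.-1 => //; lia.
case: wk => h' /IH[]; rewrite -[runs eta [:: i, j & s]]/(match runs eta (j :: s) with
    | (j :: r) :: rs => if eta i == eta j then (i :: j :: r) :: rs
        else [:: i] :: (j :: r) :: rs
    | _ => [:: [:: i]] end).
case: (runs eta (j :: s)) => [|[|j' r] rs] //= [<- Es].
case/andP=> /andP[_ alt_r] alt_rs dy hh'; case: eqVneq => [ij|nij] /=.
  split; first by rewrite Es.
    by rewrite ij !eqxx alt_r alt_rs.
  move: dy hh'; rewrite ij; case: (eta j') => [dy h'E | /andP[le_h dy] ->].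
    by rewrite -addSnnS -h'E.
  by rewrite ltnS le_h.
split; first by rewrite Es.
  by rewrite !eqxx; move: nij alt_r alt_rs; case: (eta i) (eta j') => -[] //= _ -> ->.
move: nij dy hh'; case: (eta i) (eta j') => -[] //= _.
  by move=> dy h'E; rewrite addn1 -h'E.
by move=> dy ->; rewrite subn1.
Qed.

End Runs.

(** * The slots of one soliton and the boxes kept in each run *)

Lemma drop_cat_le (T : Type) k (s1 s2 : seq T) :
  k <= size s1 -> drop k (s1 ++ s2) = drop k s1 ++ s2.
Proof. by rewrite drop_cat; case: ltngtP => // -> _; rewrite subnn drop0 drop_size. Qed.

Definition TS_soliton_slots (g : soliton) (k : nat) : seq nat :=
  [seq head_box g l | l <- iota k.+1 (soliton_size g - k)] ++
  [seq tail_box g l | l <- iota k.+1 (soliton_size g - k)].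

Definition HT_soliton_slots (g : soliton) (k : nat) : seq nat :=
  [seq head_box g l | l <- iota 1 (soliton_size g - k)] ++
  [seq tail_box g (soliton_size g - l + 1) | l <- iota 1 (soliton_size g - k)].

Lemma map_nth_pred_iota (s : seq nat) k :
  [seq nth 0 s l.-1 | l <- iota k.+1 (size s - k)] = drop k s.
Proof.
apply: (@eq_from_nth _ 0) => [|i]; first by rewrite size_map size_iota size_drop.
rewrite size_map size_iota => i_lt.
by rewrite (nth_map 0) ?size_iota // nth_iota // nth_drop.
Qed.

Lemma TS_soliton_slotsE h t k : size h = size t ->
  perm_eq (TS_soliton_slots (Soliton h t) k) (drop k h ++ drop k t).
Proof.
move=> ht; rewrite /TS_soliton_slots /head_box /tail_box /soliton_size /=.
by rewrite map_nth_pred_iota ht map_nth_pred_iota.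
Qed.

(** The [k]-slots of an HT-soliton are its first heads and its last tails; the
    definition enumerates the latter from right to left. *)
Lemma HT_soliton_slotsE h t k : size h = size t ->
  perm_eq (HT_soliton_slots (Soliton h t) k) (take (size h - k) h ++ drop k t).
Proof.
move=> ht; rewrite /HT_soliton_slots /head_box /tail_box /soliton_size /=.
have -> : [seq nth 0 h l.-1 | l <- iota 1 (size h - k)] = take (size h - k) h.
  have := map_nth_pred_iota (take (size h - k) h) 0.
  rewrite drop0 subn0 size_takel ?leq_subr // => <-.
  apply/eq_in_map => l; rewrite mem_iota => /andP[l_gt0 l_lt].
  by rewrite nth_take //; lia.
have -> : [seq nth 0 t (size h - l + 1).-1 | l <- iota 1 (size h - k)] =
          rev (drop k t).
  apply: (@eq_from_nth _ 0) => [|i].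
    by rewrite size_map size_iota size_rev size_drop ht.
  rewrite size_map size_iota => i_lt.
  rewrite (nth_map 0) ?size_iota // nth_iota // nth_rev ?size_drop -?ht // nth_drop.
  by congr nth; lia.
by rewrite perm_cat2l perm_rev.
Qed.

(** [keep] is the set of [k]-slots in a run when all runs have size at least
    [k]. For zero-runs it is the same in both decompositions; [keep1] is the
    rule for one-runs, [drop k] for TS and [take (size r - k)] for HT. *)
Definition keep (keep1 : nat -> seq nat -> seq nat) (b : bool) (k : nat) (r : seq nat) :=
  if b then keep1 k r else drop k r.
Arguments keep : simpl never.

Fixpoint kept keep1 (b : bool) (k : nat) (rs : seq (seq nat)) : seq nat :=
  if rs is r :: rs' then keep keep1 b k r ++ kept keep1 (~~ b) k rs' else [::].

Lemma kept_cat keep1 b k rs1 rs2 :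
  kept keep1 b k (rs1 ++ rs2) =
  kept keep1 b k rs1 ++ kept keep1 (b (+) odd (size rs1)) k rs2.
Proof.
elim: rs1 b => [|r rs1 IH] b /=; first by rewrite addbF.
by rewrite IH catA addNb addbN.
Qed.

(** * Removing one soliton *)

Section Scheme.
Variables (eta : int -> bool) (keep1 : nat -> seq nat -> seq nat).
Variable slots_in : soliton -> nat -> seq nat.
Hypothesis size_keep1 : forall k r, size (keep1 k r) = size r - k.
Hypothesis subseq_keep1 : forall k r, subseq (keep1 k r) r.
Hypothesis slots_inE : forall h t k, size h = size t ->
  perm_eq (slots_in (Soliton h t) k) (keep1 k h ++ drop k t).

Lemma size_keep b k r : size (keep keep1 b k r) = size r - k.
Proof. by rewrite /keep; case: b; rewrite ?size_keep1 ?size_drop. Qed.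

Lemma keep_nil b k r : size r <= k -> keep keep1 b k r = [::].
Proof. by move=> rk; apply: size0nil; rewrite size_keep; lia. Qed.

Lemma subseq_keep b k r : subseq (keep keep1 b k r) r.
Proof. by rewrite /keep; case: b; [exact: subseq_keep1 | exact: drop_subseq]. Qed.

Lemma subseq_kept b k rs : subseq (kept keep1 b k rs) (flatten rs).
Proof.
by elim: rs b => //= r rs IH b; apply: cat_subseq (IH _); exact: subseq_keep.
Qed.

Lemma size_kept b k rs :
  size (kept keep1 b k rs) = sumn [seq a - k | a <- map size rs].
Proof. by elim: rs b => //= r rs IH b; rewrite size_cat size_keep IH. Qed.

Lemma soliton_of_boxes_cat b r s :
  all (fun i : nat => eta i == b) r -> all (fun i : nat => eta i == ~~ b) s ->
  soliton_of_boxes eta (r ++ s) = if b then Soliton r s else Soliton s r.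
Proof.
move=> /allP r_b /allP s_b; rewrite /soliton_of_boxes !filter_cat.
have fr (c : bool) : [seq i : nat <- r | eta i == c] = if b == c then r else [::].
  case: eqVneq => [<-|nbc]; first by apply/all_filterP/allP.
  rewrite (eq_in_filter (a2 := pred0)) ?filter_pred0 // => i /r_b /eqP ->.
  exact: negbTE.
have fs (c : bool) : [seq i : nat <- s | eta i == c] = if ~~ b == c then s else [::].
  case: eqVneq => [<-|nbc]; first by apply/all_filterP/allP.
  rewrite (eq_in_filter (a2 := pred0)) ?filter_pred0 // => i /s_b /eqP ->.
  exact: negbTE.
have eT u : [seq i : nat <- u | eta i] = [seq i : nat <- u | eta i == true].
  by apply: eq_filter => i; rewrite eqb_id.
have eF u : [seq i : nat <- u | ~~ eta i] = [seq i : nat <- u | eta i == false].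
  by apply: eq_filter => i; rewrite eqbF_neg.
by rewrite !eT !eF !fr !fs; case: (b); rewrite /= ?cats0.
Qed.

Lemma count_slots_in_boxes b r s k (P : pred nat) :
  all (fun i : nat => eta i == b) r -> all (fun i : nat => eta i == ~~ b) s ->
  size r = size s ->
  count P (slots_in (soliton_of_boxes eta (r ++ s)) k) =
  count P (keep keep1 b k r) + count P (keep keep1 (~~ b) k s).
Proof.
move=> r_b s_b rs; rewrite (soliton_of_boxes_cat r_b s_b).
case: b {r_b s_b}; last rewrite addnC.
  by have /permP -> := slots_inE k rs; rewrite count_cat.
by have /permP -> := slots_inE k (esym rs); rewrite count_cat.
Qed.

(** What both decompositions have in common when a soliton of size [m] with
    boxes [bs] is created from run [p]: its boxes are consecutive among the
    remaining ones, the slots it contributes are those that the rule [keep]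
    loses at any level [k <= m], and the slots on its left, [L], are counted by run sizes. The slots
    [L ++ R] avoid [bs] because the soliton contributes no [m]-slot. *)
Record removal (p m : nat) (bs : seq nat) (ru ru' : seq (seq nat)) (a c : seq nat) :
    Prop := Removal {
  removal_flatten : flatten ru = a ++ bs ++ c;
  removal_flatten' : flatten ru' = a ++ c;
  removal_alternating : alternating eta true ru';
  removal_sizes : map size ru' = merge_at p (map size ru);
  removal_soliton_size : soliton_size (soliton_of_boxes eta bs) = m;
  removal_slots : forall k, k <= m ->
    perm_eq (kept keep1 true k ru)
            (slots_in (soliton_of_boxes eta bs) k ++ kept keep1 true k ru');
  removal_position : exists L R, [/\ kept keep1 true m ru = L ++ R,
    subseq L a, subseq R c
    & size L = sumn [seq x - m | x <- take p (map size ru)]]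
}.

(** The first run starts at box 1, so no zero-run of the excursion is on its
    left; the zeros paired with it exhaust the second run. *)
Lemma removal_first r y C : alternating eta true (r :: y :: C) -> size y = size r ->
  removal 0 (size r) (r ++ y) (r :: y :: C) C [::] (flatten C).
Proof.
move=> /= /and3P[_ r_b /and3P[_ y_b alt_C]] yr; split => //=.
- by rewrite catA.
- by rewrite drop0.
- by rewrite (soliton_of_boxes_cat r_b y_b).
- move=> k k_le; apply/permP=> P.
  by rewrite !count_cat (count_slots_in_boxes k P r_b y_b (esym yr)) addnA.
- exists [::], (kept keep1 true (size r) C); split => //=; last exact: subseq_kept.
  by rewrite !keep_nil ?yr //.
Qed.

Lemma alternating_inner (A : seq (seq nat)) (x r y : seq nat) C :
  alternating eta true (A ++ [:: x, r, y & C]) ->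
  let b := ~~ odd (size A) in
  [/\ alternating eta true A, all (fun i : nat => eta i == b) x,
      all (fun i : nat => eta i == ~~ b) r, all (fun i : nat => eta i == b) y
    & alternating eta (~~ b) C] /\ [/\ x != [::], r != [::] & y != [::]].
Proof.
rewrite alternating_cat addTb /= !negbK.
by move=> /andP[? /and3P[? ? /and3P[? ? /and3P[? ? ?]]]].
Qed.

Lemma merge_at_sizes (A : seq (seq nat)) (x r y : seq nat) C :
  merge_at (size A).+1 (map size (A ++ [:: x, r, y & C])) =
  map size A ++ (size x + size y - size r) :: map size C.
Proof. by rewrite map_cat -(size_map size A) merge_at_cat. Qed.

(** The soliton takes the smallest run and the first boxes of the run on its
    right. The remainder of that run follows [x], whose size is at least [m];
    if the nonslots of runs of this kind are at the left end, those of the merged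
    run are thus in [x], and all the boxes that join [x] were slots and remain
    so. *)
Lemma removal_right (A : seq (seq nat)) (x r y : seq nat) C b (m := size r) :
  b = ~~ odd (size A) ->
  keep keep1 b =2 drop -> alternating eta true (A ++ [:: x, r, y & C]) ->
  m <= size x -> m <= size y ->
  removal (size A).+1 m (r ++ take m y) (A ++ [:: x, r, y & C])
    (A ++ (x ++ drop m y) :: C) (flatten A ++ x) (drop m y ++ flatten C).
Proof.
move=> bE keep_b alt_ru; have [] := alternating_inner alt_ru.
rewrite -bE => -[alt_A x_b r_b y_b alt_C] [x0 _ _] mx my.
have [y1_b y2_b] : all (fun i : nat => eta i == b) (take m y) /\
                   all (fun i : nat => eta i == b) (drop m y).
  by move: y_b; rewrite -{1}(cat_take_drop m y) all_cat => /andP.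
have size_y1 : size (take m y) = m by rewrite size_takel.
split.
- rewrite flatten_cat /= -!catA -{1}(cat_take_drop m y) -!catA //.
- by rewrite flatten_cat /= -!catA.
- rewrite alternating_cat alt_A addTb -bE /= alt_C all_cat x_b y2_b !andbT.
  by case: (x) x0.
- by rewrite merge_at_sizes map_cat /= size_cat size_drop; congr (_ ++ _ :: _); lia.
- rewrite (soliton_of_boxes_cat r_b) ?negbK //.
  by case: (b) => //; exact: size_y1.
- move=> k k_le; apply/permP=> P.
  have := count_slots_in_boxes (s := take m y) k P r_b.
  rewrite negbK size_y1 => /(_ y1_b erefl) slots.
  rewrite !kept_cat !addTb -bE /= negbK !count_cat slots !keep_b.
  rewrite drop_cat_le ?(leq_trans k_le) // -{1}(cat_take_drop m y).
  by rewrite drop_cat_le ?size_y1 // !count_cat; lia.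
- exists (kept keep1 true m A ++ keep keep1 b m x), (keep keep1 b m y ++ kept keep1 (~~ b) m C).
  split.
  + by rewrite kept_cat addTb -bE /= negbK (keep_nil (~~ b) (leqnn m)) -!catA.
  + by apply: cat_subseq; [exact: subseq_kept | exact: subseq_keep].
  + by rewrite keep_b; apply: cat_subseq; last exact: subseq_kept.
  + rewrite size_cat size_kept size_keep map_cat /=.
    rewrite -(size_map size A) -cat_rcons take_size_cat ?size_rcons //.
    by rewrite map_rcons sumn_rcons.
Qed.

(** Mirror image of the previous situation: for HT the nonslots of a one-run
    are at its right end, so those of the merged run are in [y], and the boxes
    of [x] that remain were slots and remain so. *)
Lemma removal_left (A : seq (seq nat)) (x r y : seq nat) C (m := size r) :
  (forall k r, keep1 k r = take (size r - k) r) -> ~~ odd (size A) ->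
  alternating eta true (A ++ [:: x, r, y & C]) ->
  m <= size x -> m <= size y ->
  removal (size A).+1 m (drop (size x - m) x ++ r) (A ++ [:: x, r, y & C])
    (A ++ (take (size x - m) x ++ y) :: C)
    (flatten A ++ take (size x - m) x) (y ++ flatten C).
Proof.
move=> keep1E evA alt_ru; have [] := alternating_inner alt_ru.
rewrite evA => -[alt_A x_b r_b y_b alt_C] [_ _ y0] mx my.
set x1 := take _ x; set x2 := drop _ x.
have xE : x = x1 ++ x2 by rewrite cat_take_drop.
have [x1_b x2_b] : all (fun i : nat => eta i == true) x1 /\
                   all (fun i : nat => eta i == true) x2.
  by move: x_b; rewrite xE all_cat => /andP.
have size_x1 : size x1 = size x - m by rewrite size_takel ?leq_subr.
have size_x2 : size x2 = m by rewrite size_drop; lia.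
split.
- by rewrite flatten_cat /= {1}xE -!catA.
- by rewrite flatten_cat /= -!catA.
- rewrite alternating_cat alt_A addTb evA /= alt_C all_cat x1_b y_b !andbT.
  by case: (x1) => //; case: (y) y0.
- by rewrite merge_at_sizes map_cat /= size_cat size_x1; congr (_ ++ _ :: _); lia.
- by rewrite (soliton_of_boxes_cat x2_b).
- move=> k k_le; apply/permP=> P.
  have slots := count_slots_in_boxes k P x2_b r_b size_x2.
  rewrite !kept_cat !addTb evA /= !count_cat slots /keep /= !keep1E size_cat size_x1 size_x2.
  have -> : take (size x - k) x = x1 ++ take (m - k) x2.
    by rewrite {2}xE take_cat size_x1 ltnNge (_ : _ <= _) /=; [congr (_ ++ take _ _) |]; lia.
  have -> : take (size x - m + size y - k) (x1 ++ y) = x1 ++ take (size y - k) y.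
    by rewrite take_cat size_x1 ltnNge (_ : _ <= _) /=; [congr (_ ++ take _ _) |]; lia.
  by rewrite !count_cat; lia.
- exists (kept keep1 true m A ++ keep1 m x), (keep1 m y ++ kept keep1 false m C); split.
  + by rewrite kept_cat addTb evA /= (keep_nil false (leqnn m)) -!catA.
  + by apply: cat_subseq; [exact: subseq_kept | rewrite keep1E].
  + by apply: cat_subseq; [exact: subseq_keep1 | exact: subseq_kept].
  + rewrite size_cat size_kept size_keep1 map_cat /=.
    rewrite -(size_map size A) -cat_rcons take_size_cat ?size_rcons //.
    by rewrite map_rcons sumn_rcons.
Qed.

End Scheme.

Lemma merge_min_ge (sh : seq nat) k : sh != [::] -> dyck true 0 sh ->
  {in sh, forall a, k <= a} -> {in merge_at (min_index sh) sh, forall a, k <= a}.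
Proof.
move=> sh0 dy ge_k; have [] := min_indexP sh0 dy.
case: (min_index sh) => [|q] p_lt min_p a /=; first by move/mem_drop/ge_k.
rewrite mem_cat inE => /or3P[/mem_take/ge_k //|/eqP->|/mem_drop/ge_k //].
have := ge_k _ (mem_nth 0 (ltnW (ltnW p_lt))).
have := min_p _ (mem_nth 0 p_lt) => xy kx.
by rewrite -addnBA // (leq_trans kx) // leq_addr.
Qed.

(** The inequality [size r <= size y] holds also when [y] is the last run, by
    [dyck_last_ge]; if [r] is the first run, nonnegativity gives the reverse
    inequality. *)
Variant min_run_spec (ru : seq (seq nat)) : nat -> Prop :=
| MinRunFirst r y C of ru = r :: y :: C & size y = size r : min_run_spec ru 0
| MinRunInner A x r y C of ru = A ++ [:: x, r, y & C]
    & size r <= size x & size r <= size y : min_run_spec ru (size A).+1.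

Lemma min_runP (ru : seq (seq nat)) : ru != [::] -> dyck true 0 (map size ru) ->
  min_run_spec ru (min_index (map size ru)).
Proof.
move=> ru0 dy; have sh0 : map size ru != [::] by case: (ru) ru0.
have [] := min_indexP sh0 dy.
case: (min_index _) => [|q] p_lt min_p.
  case: ru {ru0 sh0} dy p_lt min_p => [|r [|y C]] //= /andP[yr _] _ min_p.
  apply: MinRunFirst => //; have := min_p (size y).
  rewrite !inE eqxx orbT => /(_ isT) ry.
  by apply/eqP; rewrite eqn_leq yr.
move: p_lt; rewrite size_map => p_lt.
have [A [x [r [y [C [ruE qE]]]]]] :
    exists A x r y C, ru = A ++ [:: x, r, y & C] /\ q = size A.
  exists (take q ru); have := cat_take_drop q ru; have := size_drop q ru.
  case: (drop q ru) => [|x [|r [|y C]]] /= szE ruE; try lia.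
  by exists x, r, y, C; rewrite size_takel //; lia.
rewrite qE; apply: MinRunInner (ruE) _ _; move: min_p;
  rewrite ruE qE map_cat -(size_map size A) /= nth_cat ltnNge leqnSn subSnn /=;
  apply; by rewrite mem_cat !inE eqxx ?orbT.
Qed.

Lemma merge_min (ru : seq (seq nat)) : ru != [::] -> dyck true 0 (map size ru) ->
  let sh := merge_at (min_index (map size ru)) (map size ru) in
  dyck true 0 sh /\ size sh = size ru - 2.
Proof.
move=> ru0 dy; have spec := min_runP ru0 dy.
case: spec dy => [r y C -> yr | A x r y C -> rx ry] dy.
  move: dy; rewrite /= add0n yr leqnn subnn drop0 size_map /= => dy; split=> //; lia.
rewrite merge_at_sizes; split.
  by apply: dyck_merge => //; move: dy; rewrite map_cat.
by rewrite !size_cat /= !size_map; lia.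
Qed.

(** In TS the neighbour on the right is always used, and the nonslots are at the
    left end of all runs. *)
Lemma TS_removal eta ru :
  alternating eta true ru -> dyck true 0 (map size ru) -> ru != [::] ->
  let p := min_index (map size ru) in
  exists ru' a c, removal eta (fun k r => drop k r) TS_soliton_slots p
    (nth 0 (map size ru) p) (TS_boxes eta ru p) ru ru' a c.
Proof.
have size_keep1 k (r : seq nat) : size (drop k r) = size r - k by exact: size_drop.
have subseq_keep1 k (r : seq nat) : subseq (drop k r) r by exact: drop_subseq.
move=> alt_ru dy ru0.
case: (min_runP ru0 dy) alt_ru => [r y C -> yr | A x r y C -> rx ry] alt_ru p.
  exists C, [::], (flatten C); rewrite /TS_boxes /= take_oversize ?yr //.
  exact: (removal_first size_keep1 subseq_keep1 TS_soliton_slotsE).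
have nthE (T : Type) (d : T) A' u v s : nth d (A' ++ [:: u, v & s]) (size A').+1 = v.
  by rewrite nth_cat ltnNge leqnSn subSnn.
have -> : TS_boxes eta (A ++ [:: x, r, y & C]) p = r ++ take (size r) y.
  rewrite /TS_boxes nthE -cat_rcons; congr (_ ++ take _ _).
  by rewrite /p -(size_rcons A x) nthE.
have -> : nth 0 (map size (A ++ [:: x, r, y & C])) p = size r.
  by rewrite map_cat /p -(size_map size A) nthE.
do 3!eexists.
apply: (removal_right size_keep1 subseq_keep1 TS_soliton_slotsE (b := ~~ odd (size A))) => //.
by move=> k s; rewrite /keep; case: ifP.
Qed.

(** In HT the soliton extends to the right of a one-run, into a zero-run whose
    nonslots are at the left end, and to the left of a zero-run, into a one-run
    whose nonslots are at the right end. *)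
Lemma HT_removal eta ru :
  alternating eta true ru -> dyck true 0 (map size ru) -> ru != [::] ->
  let p := min_index (map size ru) in
  exists ru' a c, removal eta (fun k r => take (size r - k) r) HT_soliton_slots p
    (nth 0 (map size ru) p) (HT_boxes eta ru p) ru ru' a c.
Proof.
pose keep1 k (r : seq nat) := take (size r - k) r.
have size_keep1 k r : size (keep1 k r) = size r - k by rewrite size_takel ?leq_subr.
have subseq_keep1 k r : subseq (keep1 k r) r by exact: take_subseq.
move=> alt_ru dy ru0.
case: (min_runP ru0 dy) alt_ru => [r y C -> yr | A x r y C -> rx ry] alt_ru p.
  exists C, [::], (flatten C); rewrite /HT_boxes /= take_oversize ?yr //.
  have -> : eta (head 0 r) = true.
    by case/and3P: alt_ru; case: (r) => //= i r' _ /andP[/eqP].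
  exact: (removal_first size_keep1 subseq_keep1 HT_soliton_slotsE).
have nthE (T : Type) (d : T) A' u v s : nth d (A' ++ [:: u, v & s]) (size A').+1 = v.
  by rewrite nth_cat ltnNge leqnSn subSnn.
have -> : HT_boxes eta (A ++ [:: x, r, y & C]) p =
    if odd (size A) then r ++ take (size r) y else drop (size x - size r) x ++ r.
  have [[_ _ r_b _ _] [_ r0 _]] := alternating_inner alt_ru.
  rewrite /HT_boxes nthE.
  have -> : eta (head 0 r) = odd (size A).
    by move: r_b r0; rewrite negbK; case: (r) => //= i r' /andP[/eqP].
  rewrite /p /= (nth_cat _ _ _ (size A)) ltnn subnn /=; case: ifP => // _.
  rewrite -cat_rcons; congr (_ ++ take _ _).
  by rewrite /p -(size_rcons A x) nthE.
have -> : nth 0 (map size (A ++ [:: x, r, y & C])) p = size r.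
  by rewrite map_cat /p -(size_map size A) nthE.
case: ifP => oddA; do 3!eexists.
  apply: (removal_right size_keep1 subseq_keep1 HT_soliton_slotsE (b := false)) => //.
  by rewrite oddA.
by apply: (removal_left size_keep1 subseq_keep1 HT_soliton_slotsE) => //; rewrite oddA.
Qed.

(** * Attachment to slots *)

Definition slots_of (slots_in : soliton -> nat -> seq nat) (D : seq soliton) (k : nat) :=
  sort leq (0 :: flatten [seq slots_in g k | g <- D & k < soliton_size g]).

(** Only the number of slots on the left of the soliton matters. The default
    value [nr] of [nth] plays the role of a slot when [sl2] is empty. *)
Lemma attached_cat sl1 sl2 nr i g : sl1 != [::] -> soliton_boxes g != [::] ->
  {in soliton_boxes g, forall b,
    [/\ all (fun c => c < b) sl1, all (fun c => b < c) sl2 & b < nr]} ->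
  i < size (sl1 ++ sl2) ->
  attached (sl1 ++ sl2) nr i g = (i.+1 == size sl1).
Proof.
move=> sl1_neq0; rewrite /attached.
case: (soliton_boxes g) => // b0 bs _ between; rewrite size_cat => i_lt.
have nth1 b j : b \in b0 :: bs -> j < size sl1 -> nth nr (sl1 ++ sl2) j < b.
  by move=> /between[/allP lt_b _ _] j_lt; rewrite nth_cat j_lt lt_b // mem_nth.
have nth2 b j : b \in b0 :: bs -> size sl1 <= j -> b < nth nr (sl1 ++ sl2) j.
  move=> /between[_ /allP lt_b b_lt] j_ge; rewrite nth_cat [j < _]ltnNge j_ge /=.
  case: (ltnP (j - size sl1) (size sl2)) => j_lt; first by rewrite lt_b // mem_nth.
  by rewrite nth_default.
case: eqVneq => [i_eq | i_neq].
  by apply/allP=> b b_in; rewrite nth1 ?nth2 // i_eq.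
apply/negbTE/negP=> /allP/(_ b0 (mem_head _ _));
case: (ltngtP i.+1 (size sl1)) i_neq => // i_s _.
  by have := nth1 b0 i.+1 (mem_head _ _) i_s; lia.
by have := nth2 b0 i (mem_head _ _) i_s; lia.
Qed.

Lemma filter_notin_mid (T : eqType) (a b c : seq T) : uniq (a ++ b ++ c) ->
  [seq i <- a ++ b ++ c | i \notin b] = a ++ c.
Proof.
rewrite !cat_uniq has_cat negb_or => /and4P[_ /andP[/hasPn ab _] _ /andP[/hasPn bc _]].
rewrite !filter_cat.
have -> : [seq i <- a | i \notin b] = a.
  by apply/all_filterP/allP=> i ia; apply/negP=> /ab; rewrite /= ia.
have -> : [seq i <- c | i \notin b] = c by apply/all_filterP/allP=> i /bc.
rewrite (eq_in_filter (a2 := pred0)) ?filter_pred0 // => i ->; exact: erefl.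
Qed.

(** * The decomposition inside a window of boxes *)

Section Window.
Variables (eta : int -> bool) (nr : nat) (t : seq nat).
Hypothesis eta0 : eta 0 = false.
Hypothesis eta_t : all (fun i : nat => eta i == false) (nr :: t).

(** Box 0 and the boxes from the next record [nr] on are the visible parts of the
    two infinite zero-runs. The second one merges with the last run of the
    excursion, which is why the runs of the window are not those of [ru]. *)
Definition window (ru : seq (seq nat)) : seq nat := 0 :: flatten ru ++ nr :: t.

Lemma runs_window R z : alternating eta true (rcons R z) ->
  dyck true 0 (map size (rcons R z)) ->
  runs eta (window (rcons R z)) = [:: 0] :: rcons R (z ++ nr :: t).
Proof.
move=> alt_ru dy; have evR : odd (size R).
  by have := odd_size_dyck dy; rewrite size_map size_rcons /=; case: odd.
have := @runs_flatten eta false ([:: 0] :: rcons R (z ++ nr :: t)).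
rewrite /= eta0 eqxx /= /window !flatten_rcons /= -!catA; apply.
move: alt_ru; rewrite -!cats1 !alternating_cat evR /=.
case/and4P=> -> z0 z_b _ /=; rewrite all_cat z_b -/(all _ (_ :: _)) eta_t andbT.
by case: (z) z0.
Qed.

Lemma smallest_runs_rcons R (z : seq nat) w :
  smallest_runs ([:: 0] :: rcons R w) =
  let sh := map size (rcons R z) in
  let finite := iota 0 (size sh).-1 in
  map succn [seq p <- finite | all (fun q => nth 0 sh p <= nth 0 sh q) finite].
Proof.
rewrite /smallest_runs /= size_map !size_rcons /= -[1]/(1 + 0) iotaDl filter_map.
congr map; apply: eq_in_filter => p; rewrite mem_iota /= add0n => p_lt.
rewrite all_map; apply: eq_in_all => q; rewrite mem_iota /= add0n => q_lt.
by rewrite !add0n !map_rcons !nth_rcons size_map p_lt q_lt !(nth_map [::]).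
Qed.

Section Attachment.
Variable boxes_of : (int -> bool) -> seq (seq nat) -> nat -> seq nat.
Variables (keep1 : nat -> seq nat -> seq nat) (slots_in : soliton -> nat -> seq nat).
Hypothesis size_slots_in : forall g k, size (slots_in g k) = (soliton_size g - k).*2.
Hypothesis boxes_window : forall R z w p, alternating eta true (rcons R z) ->
  p < size R -> size (nth [::] R p) <= size z ->
  boxes_of eta ([:: 0] :: rcons R (z ++ w)) p.+1 = boxes_of eta (rcons R z) p.
Hypothesis removalP : forall ru,
  alternating eta true ru -> dyck true 0 (map size ru) -> ru != [::] ->
  let p := min_index (map size ru) in
  exists ru' a c, removal eta keep1 slots_in p
    (nth 0 (map size ru) p) (boxes_of eta ru p) ru ru' a c.

Lemma decomposition_step fuel ru (p := min_index (map size ru)) :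
  alternating eta true ru -> dyck true 0 (map size ru) -> ru != [::] ->
  decomposition_rec boxes_of eta fuel.+1 (window ru) =
  soliton_of_boxes eta (boxes_of eta ru p)
    :: decomposition_rec boxes_of eta fuel
         [seq i <- window ru | i \notin boxes_of eta ru p].
Proof.
move=> alt_ru dy ru0.
rewrite -[LHS]/(let rs := runs eta (window ru) in
  if smallest_runs rs is p' :: _ then
    let bs := boxes_of eta rs p' in
    soliton_of_boxes eta bs
      :: decomposition_rec boxes_of eta fuel [seq i <- window ru | i \notin bs]
  else [::]).
have sh0 : map size ru != [::] by case: (ru) ru0.
have [p_lt min_p] := min_indexP sh0 dy.
have := min_index_mem (leq_ltn_trans (ltn0Sn _) p_lt).
case/lastP: ru ru0 @p sh0 alt_ru dy p_lt min_p => // R z _ p sh0 alt_ru dy p_lt min_p.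
cbv zeta; rewrite (runs_window alt_ru dy) (smallest_runs_rcons _ z).
have {}p_lt : p < size R by move: p_lt; rewrite -/p size_map size_rcons ltnS.
have boxesE : boxes_of eta ([:: 0] :: rcons R (z ++ nr :: t)) p.+1 =
    boxes_of eta (rcons R z) p.
  have sizeE : nth 0 (map size (rcons R z)) p = size (nth [::] R p).
    by rewrite (nth_map [::]) ?size_rcons ?ltnS 1?ltnW // nth_rcons p_lt.
  apply: boxes_window => //; rewrite -sizeE; apply: min_p.
  by rewrite map_rcons mem_rcons mem_head.
move: boxesE; rewrite /p /min_index; set F := filter _ _.
by case: F => [|p' F] //= ->.
Qed.

(** Attachment is compared soliton by soliton, and not only counted, so that a
    soliton can be added at the head of [D]. *)
Definition attachment_data (D : seq soliton) (J : seq (nat * nat)) : Prop :=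
  map soliton_size D = map fst J /\
  forall k i, i < size (slots_of slots_in D k) ->
    [seq attached (slots_of slots_in D k) nr i g | g <- D & soliton_size g == k] =
    [seq i == q.2 | q <- J & q.1 == k].

(** The slots of all levels [k] up to the smallest run size are controlled
    together with the attachment data: the position of the first soliton is read
    off from the slots at the level of its own size, and that claim is inherited
    from the smaller configuration, whose runs are not shorter. Each step removes
    two runs, hence the bound on [fuel]. *)
Lemma decomposition_data fuel ru (D := decomposition_rec boxes_of eta fuel (window ru)) :
  alternating eta true ru -> dyck true 0 (map size ru) ->
  sorted ltn (window ru) -> size ru <= fuel.*2 ->
  (forall k, {in map size ru, forall a, k <= a} ->
     all (fun g => k <= soliton_size g) D /\
     perm_eq (flatten [seq slots_in g k | g <- D & k < soliton_size g])
             (kept keep1 true k ru)) /\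
  attachment_data D (soliton_data fuel (map size ru)).
Proof.
rewrite {}/D; elim: fuel ru => [|fuel IH] ru alt_ru dy srt sz.
  by case: ru alt_ru dy srt sz.
case: (eqVneq ru [::]) => [->|ru0].
  have -> : decomposition_rec boxes_of eta fuel.+1 (window [::]) = [::].
    have rsE : runs eta (window [::]) = [:: window [::]].
      have := @runs_flatten eta false [:: window [::]]; rewrite /= cats0; apply.
      by move: eta_t; rewrite eta0 eqxx /= => ->.
    rewrite -[LHS]/(if smallest_runs (runs eta (window [::])) is p :: _ then _ else _).
    by rewrite rsE.
  by split=> //.
have sh0 : map size ru != [::] by case: (ru) ru0.
have [p_lt min_p] := min_indexP sh0 dy.
have [ru' [a [c]]] := removalP alt_ru dy ru0.
rewrite (decomposition_step fuel alt_ru dy ru0).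
have -> : soliton_data fuel.+1 (map size ru) =
    (nth 0 (map size ru) (min_index (map size ru)),
     sumn [seq x - nth 0 (map size ru) (min_index (map size ru))
            | x <- take (min_index (map size ru)) (map size ru)])
    :: soliton_data fuel (merge_at (min_index (map size ru)) (map size ru)).
  by case: (map size ru) sh0.
have [dy' sz'] := merge_min ru0 dy; have ge' := merge_min_ge sh0 dy.
move: p_lt dy' sz' ge' min_p; set p := min_index _; set bs := boxes_of _ _ _.
set m := nth 0 _ p => p_lt dy' sz' ge' min_p.
move=> [flE flE' alt' shE gm slots [L [R [keptE La Rc szL]]]].
have m_sh : m \in map size ru by rewrite mem_nth // ltnW.
have m_gt0 : 0 < m.
  have pos : {in map size ru, forall x, 0 < x}.
    move=> _ /mapP[r r_ru ->]; elim: (ru) (true) alt_ru r_ru => //= r' ru1 IHr b.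
    case/and3P=> r'0 _ alt1; rewrite inE => /predU1P[->|]; last exact: IHr alt1.
    by rewrite lt0n size_eq0.
  exact: (pos m m_sh).
have winE : window ru = (0 :: a) ++ bs ++ (c ++ nr :: t).
  by rewrite /window flE -!catA.
have -> : [seq i <- window ru | i \notin bs] = window ru'.
  rewrite winE filter_notin_mid; last first.
    by rewrite -winE; apply: sorted_uniq srt; [exact: ltn_trans | exact: ltnn].
  by rewrite /window flE' -!catA.
have srt' : sorted ltn (window ru').
  apply: subseq_sorted srt; first exact: ltn_trans.
  rewrite winE /window flE' -catA -cat_cons; apply: cat_subseq => //.
  exact: suffix_subseq.
have fuel' : size ru' <= fuel.*2.
  by rewrite -(size_map size) shE sz'; lia.
rewrite -shE in dy' sz' ge' *.
have [claim [szD attD]] := IH ru' alt' dy' srt' fuel'.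
set D := decomposition_rec _ _ _ _ in claim szD attD *.
set g := soliton_of_boxes eta bs in gm slots *.
(* The soliton removed contributes the slots that [keep] loses; at level m there are
   none. *)
have claim_g k : {in map size ru, forall x, k <= x} ->
   all (fun g' => k <= soliton_size g') (g :: D) /\
   perm_eq (flatten [seq slots_in g' k | g' <- g :: D & k < soliton_size g'])
           (kept keep1 true k ru).
  move=> ge_k; have [all_k perm_k] := claim k (ge' k ge_k).
  have k_m : k <= m := ge_k m m_sh.
  rewrite /= gm k_m all_k; split=> //; rewrite perm_sym.
  apply: perm_trans (slots k k_m) _; case: ltnP => [_|m_k] /=.
    by rewrite perm_cat2l perm_sym.
  have -> : slots_in g k = [::].
    by apply: size0nil; rewrite size_slots_in gm; move: m_k; rewrite -subn_eq0 => /eqP ->.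
  by rewrite perm_sym.
split=> //.
have [all_m perm_m] := claim_g m min_p.
split; first by rewrite /= szD gm.
move=> k i.
(* Below level m there is no soliton; above it the first soliton is neither a
   slot provider nor attached; at level m it provides no slot but is attached. *)
case: (ltngtP k m) => [k_m|m_k|->].
- move=> _; rewrite /= gm (gtn_eqF k_m).
  have no_k : count_mem k (map soliton_size D) = 0.
    apply/count_memPn/negP=> k_D.
    have /allP/(_ k k_D) : all (leq m) (map soliton_size D).
      by rewrite all_map; case/andP: all_m.
    by rewrite leqNgt k_m.
  have -> : [seq g' <- D | soliton_size g' == k] = [::].
    by apply: size0nil; rewrite size_filter -(count_map soliton_size (pred1 k)).
  suff -> : [seq q <- soliton_data fuel (map size ru') | q.1 == k] = [::] by [].
  by apply: size0nil; rewrite size_filter -(count_map fst (pred1 k)) -szD.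
- rewrite /slots_of /= gm (leq_gtF (ltnW m_k)) (ltn_eqF m_k) /=; exact: attD.
- have slotsE : slots_of slots_in (g :: D) m = (0 :: L) ++ R.
    apply: (sorted_eq leq_trans anti_leq).
    + exact: (sort_sorted leq_total).
    + apply: (sub_sorted (e := ltn)) => [? ?|]; first exact: ltnW.
      apply: subseq_sorted srt; first exact: ltn_trans.
      rewrite winE; apply: cat_subseq => //.
      apply: subseq_trans (suffix_subseq bs _).
      exact: subseq_trans Rc (prefix_subseq _ _).
    + by rewrite /slots_of perm_sort /= perm_cons -keptE.
  have attD' : slots_of slots_in D m = (0 :: L) ++ R.
    by rewrite -slotsE /slots_of /= gm ltnn.
  rewrite slotsE /= gm eqxx /= => i_lt; congr (_ :: _).
    rewrite -[0 :: _]/((0 :: L) ++ R) attached_cat //=.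
    + by rewrite eqSS szL.
    + by move: m_gt0; rewrite -gm /soliton_size /soliton_boxes; case: heads.
    + move=> b b_g; have b_bs : b \in bs.
        by move: b_g; rewrite mem_cat !mem_filter => /orP[] /andP[].
      move: srt; rewrite (sorted_pairwise ltn_trans) winE !pairwise_cat.
      case/and3P=> /allrelP a_lt _ /and3P[/allrelP lt_c _ _].
      split; last by apply: lt_c; rewrite // mem_cat mem_head orbT.
        apply/(@allP _ _ (0 :: L))=> x x_L; apply: a_lt; last by rewrite mem_cat b_bs.
        by move: x_L; rewrite !inE => /orP[-> //|/(mem_subseq La) ->]; rewrite orbT.
      by apply/allP=> x /(mem_subseq Rc) x_c; apply: lt_c; rewrite // mem_cat x_c.
  by have := attD m i; rewrite attD'; apply.
Qed.

End Attachment.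
End Window.

(** * From an excursion to its slot diagram *)

Lemma size_TS_soliton_slots g k : size (TS_soliton_slots g k) = (soliton_size g - k).*2.
Proof. by rewrite size_cat !size_map !size_iota addnn. Qed.

Lemma size_HT_soliton_slots g k : size (HT_soliton_slots g k) = (soliton_size g - k).*2.
Proof. by rewrite size_cat !size_map !size_iota addnn. Qed.

(** The last run of the window is longer than that of the excursion, but only its
    beginning is ever used. *)
Lemma next_run_window (R : seq (seq nat)) z w p k : p < size R -> k <= size z ->
  take k (nth [::] ([:: 0] :: rcons R (z ++ w)) p.+2) =
  take k (nth [::] (rcons R z) p.+1).
Proof.
move=> p_lt k_le; rewrite [nth _ (_ :: _) _]/= !nth_rcons.
by case: (ltngtP p.+1 (size R)) p_lt => // _ _; rewrite takel_cat.
Qed.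

Lemma TS_boxes_window eta R z w p :
  alternating eta true (rcons R z) -> p < size R -> size (nth [::] R p) <= size z ->
  TS_boxes eta ([:: 0] :: rcons R (z ++ w)) p.+1 = TS_boxes eta (rcons R z) p.
Proof.
move=> _ p_lt k_le; rewrite /TS_boxes.
have rE w' : nth [::] (rcons R w') p = nth [::] R p by rewrite nth_rcons p_lt.
by rewrite next_run_window ?rE // [nth _ (_ :: _) _]/= !rE.
Qed.

Lemma HT_boxes_window eta R z w p :
  alternating eta true (rcons R z) -> p < size R -> size (nth [::] R p) <= size z ->
  HT_boxes eta ([:: 0] :: rcons R (z ++ w)) p.+1 = HT_boxes eta (rcons R z) p.
Proof.
move=> alt_ru p_lt k_le; rewrite /HT_boxes.
have rE w' : nth [::] (rcons R w') p = nth [::] R p by rewrite nth_rcons p_lt.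
have rE' w' : nth [::] ([:: 0] :: rcons R w') p.+1 = nth [::] R p by exact: rE.
rewrite next_run_window ?rE' // !rE; case: ifP => // eta_r.
case: p p_lt {k_le rE rE'} eta_r => [|q] q_lt eta_r.
  case: R alt_ru q_lt eta_r => //= r R /and3P[r0 r_b _] _.
  by case: r r0 r_b => //= i r _ /andP[/eqP -> _].
by rewrite /= !nth_rcons (ltnW q_lt).
Qed.

Definition diagram_of_data (J : seq (nat * nat)) : seq (seq nat) :=
  [seq mkseq (fun i => count (fun q => (q.1 == k) && (i == q.2)) J)
             (sumn [seq (d - k).*2 | d <- map fst J & k < d]).+1
     | k <- iota 1 (\max_(q <- J) q.1)].

Lemma slot_diagram_data slots_in n D J :
  (forall g k, size (slots_in g k) = (soliton_size g - k).*2) ->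
  attachment_data n.*2.+1 slots_in D J ->
  slot_diagram (slots_of slots_in) n D = diagram_of_data J.
Proof.
move=> size_slots_in [szD attD]; rewrite /slot_diagram /diagram_of_data.
have -> : max_soliton_size D = \max_(q <- J) q.1.
  by rewrite /max_soliton_size -(big_map soliton_size predT id) szD big_map.
apply: eq_map => k; rewrite /slot_vector.
have size_sl : size (slots_of slots_in D k) =
    (sumn [seq (d - k).*2 | d <- map fst J & k < d]).+1.
  rewrite size_sort /= size_flatten -szD filter_map -map_comp /shape -map_comp.
  by congr (sumn _).+1; apply: eq_map => g /=; rewrite size_slots_in.
apply: (@eq_from_nth _ 0) => [|i]; rewrite !size_mkseq // => i_lt.
rewrite !nth_mkseq -?size_sl //.
have := congr1 (count id) (attD k i i_lt); rewrite !count_map => ->.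
rewrite count_filter; apply: eq_count => q /=; by rewrite andbC.
Qed.

(** The heights of the excursion are followed from its end, since the runs of a
    list are computed from its end. *)
Lemma excursion_runs n eps : soft_excursion n eps ->
  let eta := ball_config n eps in
  exists ru, [/\ flatten ru = iota 1 n.*2, alternating eta true ru
    & dyck true 0 (map size ru)].
Proof.
move=> [_ eps0 eps2n step] eta.
have stepE i : i < n.*2 ->
    (`|Posz (nth 0%N eps i.+1) - Posz (nth 0%N eps i)| = 1)%R.
  exact: (step i.+1).
have etaE i : i < n.*2 ->
    eta i.+1 = (Posz (nth 0%N eps i.+1) - Posz (nth 0%N eps i) == 1)%R.
  by move=> i_lt; rewrite /eta /= i_lt.
have wk j : j <= n.*2 -> walk eta (nth 0 eps (n.*2 - j)) (iota (n.*2 - j).+1 j).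
  elim: j => [|j IH] j_le; first by rewrite subn0 eps2n /=.
  have nj : (n.*2 - j.+1).+1 = n.*2 - j by lia.
  have {IH} := IH (ltnW j_le); rewrite -nj; set i := n.*2 - j.+1 => wk.
  have i_lt : i < n.*2 by rewrite /i; lia.
  rewrite -[walk _ _ _]/(if eta i.+1 then walk eta (nth 0 eps i).+1 (iota i.+2 j)
    else (0 < nth 0 eps i) && walk eta (nth 0 eps i).-1 (iota i.+2 j)).
  have d1 := stepE i i_lt; rewrite (etaE i i_lt); case: eqP => d.
    by rewrite (_ : (nth 0 eps i).+1 = nth 0 eps i.+1) //; lia.
  by rewrite (_ : (nth 0 eps i).-1 = nth 0 eps i.+1) ?wk ?andbT; lia.
have := wk _ (leqnn _); rewrite subnn eps0.
case: n {eps0 eps2n step stepE etaE wk} @eta => [|n] eta; first by exists [::].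
rewrite doubleS => wk; have [fl alt dy] := runs_walk wk.
have eta1 : eta 1 = true := walk0_head wk.
by rewrite eta1 in alt dy; exists (runs eta (iota 1 n.*2.+2)).
Qed.

Lemma decomposition_diagram boxes_of keep1 slots_in n eps ru
    (eta := ball_config n eps) :
  (forall g k, size (slots_in g k) = (soliton_size g - k).*2) ->
  (forall R z w p, alternating eta true (rcons R z) ->
    p < size R -> size (nth [::] R p) <= size z ->
    boxes_of eta ([:: 0] :: rcons R (z ++ w)) p.+1 = boxes_of eta (rcons R z) p) ->
  (forall ru', alternating eta true ru' -> dyck true 0 (map size ru') -> ru' != [::] ->
    let p := min_index (map size ru') in
    exists ru'' a c, removal eta keep1 slots_in p
      (nth 0 (map size ru') p) (boxes_of eta ru' p) ru' ru'' a c) ->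
  flatten ru = iota 1 n.*2 -> alternating eta true ru -> dyck true 0 (map size ru) ->
  slot_diagram (slots_of slots_in) n (decomposition boxes_of n eps) =
  diagram_of_data (soliton_data n (map size ru)).
Proof.
move=> size_slots_in boxes_window removalP fl alt_ru dy.
apply: slot_diagram_data => //.
have windowE : iota 0 (3 * n).+2 = window n.*2.+1 (iota n.*2.+2 n) ru.
  by rewrite /window fl (_ : (3 * n).+2 = (1 + n.*2) + n.+1) ?iotaD //; lia.
rewrite /decomposition windowE.
have eta_t : all (fun i : nat => eta i == false) (n.*2.+1 :: iota n.*2.+2 n).
  rewrite -[_ :: _]/(iota n.*2.+1 n.+1); apply/allP=> i.
  by rewrite mem_iota /eta /= => /andP[i_gt _]; rewrite [i <= _]leqNgt i_gt andbF.
have [] := decomposition_data (fuel := n) (erefl : eta 0 = false) eta_t size_slots_in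
  boxes_window removalP alt_ru dy => //.
  by rewrite -windowE iota_ltn_sorted.
have : size ru <= size (flatten ru).
  elim: (ru) (true) alt_ru => //= r ru1 IH b /and3P[r0 _ /IH].
  by case: r r0 => //= i r _; rewrite size_cat; lia.
by rewrite fl size_iota.
Qed.

Theorem theorem2 (n : nat) (eps : seq nat) (Heps : soft_excursion n eps) :
  TS_slot_diagram n eps = HT_slot_diagram n eps.
Proof.
have [ru [fl alt_ru dy]] := excursion_runs Heps.
transitivity (diagram_of_data (soliton_data n (map size ru))).
  apply: (decomposition_diagram (keep1 := fun k r => drop k r)) fl alt_ru dy.
  - exact: size_TS_soliton_slots.
  - exact: TS_boxes_window.
  - exact: TS_removal.
symmetry.
apply: (decomposition_diagram (keep1 := fun k r => take (size r - k) r)) fl alt_ru dy.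
- exact: size_HT_soliton_slots.
- exact: HT_boxes_window.
- exact: HT_removal.
Qed.
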